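(* For every integer $d\ge 2$ there exist nonproportional (i.e. linearly independent over $\mathbb{C}$) functions $f,g\in\mathcal{S}(\mathbb{R}^d)$ such that $$|e^{it\Delta}f(x)|=|e^{it\Delta}g(x)|\quad\text{for every }(t,x)\in\mathbb{R}\times\mathbb{R}^d.$$
   Context: $\mathcal{S}(\mathbb{R}^d)$ is the space of complex-valued Schwartz functions on $\mathbb{R}^d$. For $f\in\mathcal{S}(\mathbb{R}^d)$, $u(t,x)=e^{it\Delta}f(x)$ denotes the solution of the free Schrödinger equation $i\partial_tu+\Delta u=0$ on $\mathbb{R}\times\mathbb{R}^d$ with $u(0,\cdot)=f$; equivalently, $e^{it\Delta}$ is the Fourier multiplier $e^{-4\pi^2it|\xi|^2}$ for the Fourier transform $\widehat f(\xi)=\int_{\mathbb{R}^d}e^{-2\pi i x\cdot\xi}f(x)\,dx$. *)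

(* Defs.v *)
From HB Require Import structures.
From mathcomp Require Import all_boot all_order all_algebra.
From mathcomp Require Import complex.
From mathcomp Require Import all_classical all_reals all_analysis.

Set Implicit Arguments.
Unset Strict Implicit.
Unset Printing Implicit Defensive.

Import Order.TTheory GRing.Theory Num.Theory.
Import numFieldNormedType.Exports.

#[global] Open Scope classical_set_scope.
#[global] Open Scope complex_scope.
#[global] Open Scope ring_scope.

(* Lebesgue measure on R^n lives on [n.-tuple R], which carries the product
   sigma-algebra; it is the n-fold product of the Lebesgue measure on R, built
   through R^(n+1) = R x R^n, with R^0 a single point of mass 1. *)

Definition cons_pair (T : Type) (n : nat) (p : T * n.-tuple T) : n.+1.-tuple T :=
  [tuple of p.1 :: p.2].

Lemma measurable_cons_pair (d : measure_display) (T : measurableType d)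
    (n : nat) : measurable_fun [set: T * n.-tuple T] (@cons_pair T n).
Proof. exact: (measurable_cons measurable_fst measurable_snd). Qed.

Section lebesgue_step.
Context (R : realType) (n : nat).
Local Notation RT := (measurableTypeR R).
Variable mu : {sigma_finite_measure set (n.-tuple RT) -> \bar R}.
Local Open Scope ereal_scope.

Definition lebesgue_step : set (n.+1.-tuple RT) -> \bar R :=
  pushforward (@lebesgue_measure R \x mu) (@cons_pair RT n).

Let step0 : lebesgue_step set0 = 0.
Proof. by rewrite /lebesgue_step /pushforward preimage_set0 measure0. Qed.

Let step_ge0 A : 0 <= lebesgue_step A.
Proof. by apply: integral_ge0 => *; exact: measure_ge0. Qed.

Let step_sigma_additive : semi_sigma_additive lebesgue_step.
Proof.
have mc := @measurable_cons_pair _ RT n.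
move=> F mF tF mUF; rewrite /lebesgue_step /pushforward preimage_bigcup.
apply: measure_semi_sigma_additive.
- by move=> k; rewrite -[X in measurable X]setTI; exact: mc.
- apply/trivIsetP => /= i j _ _ ij; rewrite -preimage_setI.
  by move/trivIsetP : tF => /(_ _ _ _ _ ij) ->//; rewrite preimage_set0.
- by rewrite -preimage_bigcup -[X in measurable X]setTI; exact: mc.
Qed.

HB.instance Definition _ := isMeasure.Build _ _ _ lebesgue_step
  step0 step_ge0 step_sigma_additive.

Let step_sigma_finite : sigma_finite [set: n.+1.-tuple RT] lebesgue_step.
Proof.
have /sigma_finiteP[F [FT ndF Foo]] := sigma_finiteT (@lebesgue_measure R).
have /sigma_finiteP[G [GT ndG Goo]] := sigma_finiteT mu.
pose uncons (t : n.+1.-tuple RT) : RT * n.-tuple RT :=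
  (thead t, [tuple of behead t]).
have consK : cancel (@cons_pair RT n) uncons.
  by case=> a t; congr pair; apply/val_inj.
have muncons : measurable_fun [set: n.+1.-tuple RT] uncons.
  apply: measurable_fun_pair; last exact: measurable_behead.
  exact: measurable_tnth.
exists (fun k => uncons @^-1` (F k `*` G k)).
  rewrite -preimage_bigcup (_ : \bigcup_k _ = setT) ?preimage_setT//.
  rewrite -setXTT FT GT predeqE => -[x y]; split.
    by case=> k _ []; split; exists k.
  move=> [/= [i _ Fix] [j _ Gjy]]; exists (maxn i j) => //; split.
    by move: x Fix; exact/subsetPset/ndF/leq_maxl.
  by move: y Gjy; exact/subsetPset/ndG/leq_maxr.
move=> k; have [mF Foo'] := Foo k; have [mG Goo'] := Goo k; split.
  by rewrite -[X in measurable X]setTI; apply: muncons => //; exact: measurableX.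
rewrite /lebesgue_step /pushforward -comp_preimage.
rewrite (_ : uncons \o _ = id); last by apply/funext => p; exact: consK.
by rewrite preimage_id product_measure1E// lte_mul_pinfty// ge0_fin_numE.
Qed.

HB.instance Definition _ := Measure_isSigmaFinite.Build _ _ _ lebesgue_step
  step_sigma_finite.

End lebesgue_step.

Fixpoint lebesgue_Rn (R : realType) (n : nat) :
    {sigma_finite_measure set (n.-tuple (measurableTypeR R)) -> \bar R} :=
  if n is m.+1 then lebesgue_step (lebesgue_Rn R m) else \d_ [tuple].

(* The library has no integral or derivative of complex-valued functions of
   real variables; both are taken on real and imaginary parts. *)

Definition integral_Rn (R : realType) (n : nat) (F : 'rV[R]_n -> R[i]) : R[i] :=
  let row (t : n.-tuple R) : 'rV[R]_n := \row_i tnth t i in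
  (\int[lebesgue_Rn R n]_t complex.Re (F (row t)))
  +i* (\int[lebesgue_Rn R n]_t complex.Im (F (row t))).

(* The canonical norm on ['rV_n] is the sup norm, hence the explicit Euclidean
   inner product. *)
Definition dot (R : realType) (n : nat) (x y : 'rV[R]_n) : R :=
  \sum_i x ord0 i * y ord0 i.

Definition expi (R : realType) (a : R) : R[i] := cos a +i* sin a.

Definition fourier (R : realType) (n : nat) (f : 'rV[R]_n -> R[i])
    (xi : 'rV[R]_n) : R[i] :=
  integral_Rn (fun x => expi (- (2 * pi * dot x xi)) * f x).

Definition inverse_fourier (R : realType) (n : nat) (h : 'rV[R]_n -> R[i])
    (x : 'rV[R]_n) : R[i] :=
  integral_Rn (fun xi => expi (2 * pi * dot x xi) * h xi).

(* e^{it Delta} f, as the Fourier multiplier e^{-4 pi^2 i t |xi|^2}. *)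
Definition schrodinger (R : realType) (n : nat) (t : R)
    (f : 'rV[R]_n -> R[i]) : 'rV[R]_n -> R[i] :=
  inverse_fourier
    (fun xi => expi (- (4 * pi ^+ 2 * t * dot xi xi)) * fourier f xi).

Definition basis_vector (R : realType) (n : nat) (i : 'I_n) : 'rV[R]_n :=
  delta_mx ord0 i.

Definition partial (R : realType) (n : nat) (i : 'I_n) (f : 'rV[R]_n -> R[i])
    (x : 'rV[R]_n) : R[i] :=
  ('D_(basis_vector R i) (@complex.Re R \o f) x)
  +i* ('D_(basis_vector R i) (@complex.Im R \o f) x).

(* Iterated partial derivatives, indexed by the sequence of directions. *)
Definition partials (R : realType) (n : nat) (s : seq 'I_n)
    (f : 'rV[R]_n -> R[i]) : 'rV[R]_n -> R[i] :=
  foldr (@partial R n) f s.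

Definition smooth (R : realType) (n : nat) (f : 'rV[R]_n -> R[i]) : Prop :=
  forall s : seq 'I_n,
    let u := @complex.Re R \o partials s f in
    let v := @complex.Im R \o partials s f in
    [/\ continuous u, continuous v,
        forall i x, derivable u x (basis_vector R i) &
        forall i x, derivable v x (basis_vector R i)].

Definition monomial (R : realType) (n : nat) (a : {ffun 'I_n -> nat})
    (x : 'rV[R]_n) : R :=
  \prod_i x ord0 i ^+ a i.

Definition schwartz (R : realType) (n : nat) (f : 'rV[R]_n -> R[i]) : Prop :=
  smooth f /\
  forall (a : {ffun 'I_n -> nat}) (s : seq 'I_n),
    exists C : R, forall x : 'rV[R]_n,
      `|(monomial a x)%:C * partials s f x| <= C%:C.

Definition linearly_independent (R : realType) (n : nat)
    (f g : 'rV[R]_n -> R[i]) : Prop :=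
  forall a b : R[i], (forall x, a * f x + b * g x = 0) -> a = 0 /\ b = 0.

(* Main.v *)
Require Import Defs.
From mathcomp Require Import all_boot all_order all_algebra.
From mathcomp Require Import complex.
From mathcomp Require Import all_classical all_reals all_analysis.
From mathcomp Require Import measurable_realfun ring lra.

(** The witnesses are the two vortices of opposite circulation

      f(x) = (x_0 + i x_1) e^(-pi |x|^2),   g(x) = (x_0 - i x_1) e^(-pi |x|^2).

    They are linearly independent, and each is an eigenfunction of the Fourier
    transform.  The flow only widens and chirps the Gaussian factor: for a
    function K that does not depend on the sign,

      e^(it Delta) f (x) = K(t, x) (x_0 + i x_1),
      e^(it Delta) g (x) = K(t, x) (x_0 - i x_1),

    and x_0 + i x_1 and x_0 - i x_1 are conjugate, so the moduli agree
    ([schrodinger_vortex]).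

    No closed form of a Gaussian integral is used, only one identity in one
    variable.  Let A and B be the integrals over the real line of
    e^(-pi x^2) e^(i (b x - a x^2)) and of x times it.  Integrating the
    derivative of the first integrand gives (2 pi + 2 i a) B = i b A
    ([chirp_by_parts]): inserting a factor x_k in a Gaussian integral multiplies
    it by a constant times the k-th frequency.  For a = 0, differentiating A in
    b under the integral sign gives A' = i B, so the identity becomes the
    equation A' = - b / (2 pi) A, and A is a multiple of e^(- b^2 / (4 pi))
    ([cintegral_chirp1_gauss]); this identifies the Fourier transform of a
    vortex.  For a = 4 pi^2 t, the same identity computes the inverse transform
    of the evolved vortex.

    Both transforms reduce to one variable because each of the two terms of a
    vortex, times the oscillating exponential, is a tensor product
    ([cintegral_tensor]).

    A polynomial times the Gaussian is Schwartz because such products are stable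
    under partial derivatives and a polynomial grows more slowly than
    e^(eps |x|^2) for every eps > 0 ([polyfun_le_expR]). *)

Set Implicit Arguments.
Unset Strict Implicit.
Unset Printing Implicit Defensive.

Import Order.TTheory GRing.Theory Num.Theory.
Import numFieldNormedType.Exports.

(** * Gaussian integrals on the line *)

Section gaussian_line.
Context {R : realType}.
Notation leb := (@lebesgue_measure R).

Lemma is_derive_continuous (F f : R -> R) :
  (forall x : R, is_derive x (1 : R) F (f x)) -> continuous F.
Proof.
move=> dF x; apply/differentiable_continuous/derivable1_diffP.
by have [] := dF x.
Qed.

(** The fundamental theorem of calculus on [-n, n], passed to the limit by
    dominated convergence; the dominating function is |f|, so that f may change
    sign. *)
Lemma Rintegral_derivative (F f : R -> R) :
  (forall x : R, is_derive x (1 : R) F (f x)) -> continuous f ->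
  leb.-integrable [set: R] (EFin \o f) ->
  F (n%:R) @[n --> \oo] --> (0 : R) -> F (- n%:R) @[n --> \oo] --> (0 : R) ->
  \int[leb]_x f x = 0.
Proof.
move=> dF cf intf Fy FNy.
have cF := is_derive_continuous dF.
pose f_ (n : nat) : R -> \bar R := (EFin \o f) \_ `[- n%:R, n%:R].
have mf := measurable_int _ intf.
have [| | |_ _ cvgf] := @dominated_convergence _ _ _ leb _ measurableT f_
    (EFin \o f) (abse \o (EFin \o f)) _ mf _ (integrable_abse intf).
  - move=> n; rewrite /f_; apply/(measurable_restrictT _ _).1 => //.
    exact: measurable_funTS.
  - apply: aeW => x _; apply: cvg_near_cst.
    near=> n; rewrite /f_ patchE ifT// inE/= in_itv/= -ler_norml.
    by near: n; exact: nbhs_infty_ger.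
  - apply: aeW => x n _; rewrite /f_ patchE; case: ifPn => // _.
    by rewrite abse0 abse_ge0.
have FE n : (\int[leb]_x (f_ n.+1 x) = (F n.+1%:R - F (- n.+1%:R))%:E)%E.
  (* the shift to n + 1 keeps the interval nondegenerate *)
  rewrite /f_ -integral_mkcond EFinB; apply: continuous_FTC2.
  - by rewrite gtrN.
  - exact: continuous_subspaceT.
  - split; first by move=> x _; have [] := dF x.
    + exact/cvg_at_right_filter/cF.
    + exact/cvg_at_left_filter/cF.
  - by move=> x _; rewrite derive1E; exact: (@derive_val _ _ _ _ _ _ _ (dF x)).
have lim0 : (\int[leb]_x (f_ n x))%E @[n --> \oo] --> (0 : \bar R).
  rewrite -cvg_shiftS /=; under eq_fun do rewrite FE.
  apply: cvg_EFin; first exact: nearW.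
  rewrite -(subr0 0); apply: cvgB.
    by move: Fy; rewrite -cvg_shiftS.
  by move: FNy; rewrite -cvg_shiftS.
rewrite /Rintegral.
have -> : (\int[leb]_x (f x)%:E = 0)%E by apply: (cvg_unique _ cvgf lim0).
by [].
Unshelve. all: end_near. Qed.

Definition gauss (x : R) : R := expR (- (pi * x ^+ 2)).

Lemma integrable_expR_sqr (a : R) : 0 < a ->
  leb.-integrable [set: R] (EFin \o (fun x => expR (- (a * x ^+ 2)))).
Proof.
move=> a0.
(* the standard deviation of the normal density proportional to e^(-a x^2) *)
pose s := Num.sqrt ((a *+ 2)^-1).
have s0 : s != 0 by rewrite gt_eqF// sqrtr_gt0 invr_gt0 pmulrn_rgt0.
have := integrable_normal_pdf 0 s.
move=> /(integrableZl measurableT (normal_peak s)^-1).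
apply: eq_integrable => // x _ /=.
rewrite /normal_pdf (negbTE s0) /normal_fun subr0 -EFinM mulrA mulVf ?mul1r.
  rewrite /s sqr_sqrtr ?invr_ge0 ?mulrn_wge0 ?ltW//.
  congr (expR _)%:E.
  rewrite mulNr; congr (- _).
  by field; rewrite gt_eqF.
by rewrite gt_eqF// normal_peak_gt0.
Qed.

Lemma ler_norm_expR_sqr (x : R) : `|x| <= expR (pi / 2 * x ^+ 2).
Proof.
apply: le_trans (expR_ge1Dx _).
have := pi_ge2 R; have := sqr_ge0 (`|x| - 1).
have -> : x ^+ 2 = `|x| ^+ 2 by rewrite real_normK ?num_real.
by move=> h1 h2; nra.
Qed.

(** Half of the Gaussian absorbs a factor of at most linear growth; the other
    half is integrable. *)
Lemma integrable_gaussM (h : R -> R) (C : R) : measurable_fun setT h ->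
  (forall x, `|h x| <= C * `|x| \/ `|h x| <= C) ->
  leb.-integrable [set: R] (EFin \o (fun x => h x * gauss x)).
Proof.
move=> mh hC.
have half0 : 0 < pi / 2 :> R by rewrite divr_gt0 ?pi_gt0.
have := integrableZl measurableT `|C| (integrable_expR_sqr half0).
apply: le_integrable => //.
  apply/measurable_EFinP/measurable_funM => //.
  apply: measurableT_comp => //; apply: measurableT_comp => //.
  exact: measurable_funM.
move=> x _ /=; rewrite lee_fin !normrM normr_id.
have -> : gauss x = expR (- (pi / 2 * x ^+ 2)) * expR (- (pi / 2 * x ^+ 2)).
  by rewrite -expRD /gauss; congr expR; field.
rewrite normrM !(@ger0_norm _ (expR _)) ?expR_ge0 //.
rewrite mulrA ler_pM2r ?expR_gt0// expRN ler_pdivrMr ?expR_gt0//.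
have e1 : 1 <= expR (pi / 2 * x ^+ 2).
  by rewrite -[leLHS]expR0 ler_expR mulr_ge0 ?sqr_ge0 ?(ltW half0).
case: (hC x) => /le_trans; apply.
  apply: (@le_trans _ _ (`|C| * `|x|)); first by rewrite ler_wpM2r// ler_norm.
  by rewrite ler_wpM2l// ler_norm_expR_sqr.
by rewrite (le_trans (ler_norm C))// ler_peMr.
Qed.

End gaussian_line.

(** * Integrals of complex-valued functions *)

Section complex_integral.
Context d (T : measurableType d) (R : realType).
Variable mu : {measure set T -> \bar R}.
Implicit Types F G : T -> R[i].

Definition cintegral F : R[i] :=
  (\int[mu]_x complex.Re (F x)) +i* (\int[mu]_x complex.Im (F x)).

Definition cintegrable F :=
  mu.-integrable [set: T] (EFin \o (fun x => complex.Re (F x))) /\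
  mu.-integrable [set: T] (EFin \o (fun x => complex.Im (F x))).

Lemma ReM (z w : R[i]) :
  complex.Re (z * w) = complex.Re z * complex.Re w - complex.Im z * complex.Im w.
Proof. by case: z; case: w. Qed.

Lemma ImM (z w : R[i]) :
  complex.Im (z * w) = complex.Re z * complex.Im w + complex.Im z * complex.Re w.
Proof. by case: z; case: w. Qed.

Lemma cintegrableD F G : cintegrable F -> cintegrable G ->
  cintegrable (fun x => F x + G x).
Proof.
move=> [F1 F2] [G1 G2]; split.
  apply: eq_integrable (integrableD measurableT F1 G1) => // x _ /=.
  by rewrite raddfD.
apply: eq_integrable (integrableD measurableT F2 G2) => // x _ /=.
by rewrite raddfD.
Qed.

Lemma cintegralD F G : cintegrable F -> cintegrable G ->
  cintegral (fun x => F x + G x) = cintegral F + cintegral G.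
Proof.
move=> [F1 F2] [G1 G2]; rewrite /cintegral.
under eq_Rintegral do rewrite raddfD.
under [X in _ +i* X]eq_Rintegral do rewrite raddfD.
by rewrite !RintegralD.
Qed.

Let integrable_scale (k : R) (f : T -> R) :
  mu.-integrable [set: T] (EFin \o f) ->
  mu.-integrable [set: T] (EFin \o (fun x => k * f x)).
Proof. by move=> /(integrableZl measurableT k); apply: eq_integrable. Qed.

Lemma cintegrableZ (c : R[i]) F :
  cintegrable F -> cintegrable (fun x => c * F x).
Proof.
move=> [F1 F2].
pose a := complex.Re c; pose b := complex.Im c.
split.
  have := integrableB measurableT (integrable_scale a F1) (integrable_scale b F2).
  by apply: eq_integrable => // x _; rewrite /= ReM.
have := integrableD measurableT (integrable_scale a F2) (integrable_scale b F1).
by apply: eq_integrable => // x _; rewrite /= ImM.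
Qed.

Lemma cintegralZ (c : R[i]) F : cintegrable F ->
  cintegral (fun x => c * F x) = c * cintegral F.
Proof.
case: c => a b [F1 F2]; rewrite /cintegral.
under eq_Rintegral do rewrite ReM /=.
under [X in _ +i* X]eq_Rintegral do rewrite ImM /=.
by rewrite RintegralB ?RintegralD ?RintegralZl //; exact: integrable_scale.
Qed.

End complex_integral.

(** * Gaussian chirps and integration by parts *)

Section chirp.
Context {R : realType}.
Notation leb := (@lebesgue_measure R).

(** The weight [p] is 1 or x.  The frequency [b] is the dual variable of the
    Fourier transform up to a factor 2 pi; the quadratic phase [a] is the effect
    of the flow. *)
Definition chirp (p : R -> R) (a b : R) (x : R) : R[i] :=
  (p x * gauss x)%:C * expi (b * x - a * x ^+ 2).

Lemma Re_chirp p a b x : complex.Re (chirp p a b x) =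
  p x * (gauss x * cos (b * x - a * x ^+ 2)).
Proof. by rewrite /chirp /expi /= mul0r subr0 mulrA. Qed.

Lemma Im_chirp p a b x : complex.Im (chirp p a b x) =
  p x * (gauss x * sin (b * x - a * x ^+ 2)).
Proof. by rewrite /chirp /expi /= mul0r addr0 mulrA. Qed.

Lemma cintegrable_chirp (C : R) (p : R -> R) a b : measurable_fun [set: R] p ->
  (forall x, `|p x| <= C * `|x| \/ `|p x| <= C) ->
  cintegrable leb (chirp p a b).
Proof.
move=> mp pC.
have mphase : measurable_fun [set: R] (fun x : R => b * x - a * x ^+ 2).
  by apply: measurable_funB; apply: measurable_funM.
have int (t : R -> R) : continuous t -> (forall y, `|t y| <= 1) ->
    leb.-integrable [set: R]
      (EFin \o (fun x => p x * (gauss x * t (b * x - a * x ^+ 2)))).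
  move=> ct t1.
  have -> : (fun x => p x * (gauss x * t (b * x - a * x ^+ 2))) =
      (fun x => p x * t (b * x - a * x ^+ 2) * gauss x).
    by apply/funext => x; rewrite mulrAC mulrA.
  apply: (@integrable_gaussM _ _ C).
    apply: measurable_funM => //; apply: measurableT_comp => //.
    exact: continuous_measurable_fun.
  move=> x; rewrite normrM.
  have le1 : `|p x| * `|t (b * x - a * x ^+ 2)| <= `|p x| by rewrite ler_piMr.
  by case: (pC x) => pCx; [left|right]; exact: le_trans pCx.
split.
  under eq_fun do rewrite Re_chirp.
  by apply: int => [|y]; [exact: continuous_cos|rewrite ler_norml cos_geN1 cos_le1].
under eq_fun do rewrite Im_chirp.
by apply: int => [|y]; [exact: continuous_sin|rewrite ler_norml sin_geN1 sin_le1].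
Qed.

Lemma cintegrable_chirp1 a b : cintegrable leb (chirp (cst 1) a b).
Proof. by apply: (@cintegrable_chirp 1) => // x; right; rewrite normr1. Qed.

Lemma cintegrable_chirp_id a b : cintegrable leb (chirp id a b).
Proof. by apply: (@cintegrable_chirp 1) => // x; left; rewrite mul1r. Qed.

Lemma is_derive_gauss (x : R) :
  is_derive x (1 : R) gauss (- (2 * pi * x) * gauss x).
Proof.
rewrite (_ : gauss = expR \o (- (pi \*: (@id R ^+ 2)))); last first.
  by apply/funext => y; rewrite /gauss !fctE.
apply: is_derive_eq.
rewrite !fctE /= mulrC; congr (_ * _).
by rewrite expr1 /GRing.scale /=; ring.
Qed.

Lemma is_derive_phase (a b x : R) :
  is_derive x (1 : R) (fun x => b * x - a * x ^+ 2) (b - 2 * a * x).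
Proof.
rewrite (_ : (fun _ => _) = (b \*: @id R) - (a \*: (@id R ^+ 2))); last first.
  by apply/funext => y; rewrite !fctE.
apply: is_derive_eq.
by rewrite expr1 /GRing.scale /=; ring.
Qed.

(** Meant for cosine and sine, that is, for the real and the imaginary part of
    the chirp of weight 1. *)
Lemma is_derive_gauss_trig (t t' : R -> R) (a b x : R) :
  (forall y, is_derive y (1 : R) t (t' y)) ->
  is_derive x (1 : R) (fun x => gauss x * t (b * x - a * x ^+ 2))
    (- (2 * pi) * (x * (gauss x * t (b * x - a * x ^+ 2)))
     + (b - 2 * a * x) * (gauss x * t' (b * x - a * x ^+ 2))).
Proof.
move=> dt.
rewrite (_ : (fun _ => _) = gauss * (t \o (fun x => b * x - a * x ^+ 2))) //.
have dg := is_derive_gauss x.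
have dp := is_derive_phase a b x.
have dtp := @is_derive1_comp _ t (fun x => b * x - a * x ^+ 2) _ _ _ (dt _) dp.
apply: is_derive_eq.
by rewrite /GRing.scale /=; ring.
Qed.

Lemma cvg_gauss_trig (t : R -> R) (a b : R) (u : nat -> R) :
  (forall y, `|t y| <= 1) -> (forall n, `|u n| = n%:R) ->
  gauss (u n) * t (b * u n - a * u n ^+ 2) @[n --> \oo] --> (0 : R).
Proof.
move=> t1 un.
(* e^(-pi n^2) <= 1 / n for n > 0 *)
rewrite -cvg_shiftS /=; apply: norm_cvg0.
apply: (@squeeze_cvgr _ _ _ _ (cst 0) (@harmonic R)); last 2 first.
- exact: cvg_cst.
- exact: cvg_harmonic.
apply: nearW => n; rewrite normr_ge0 normrM /=.
have g0 : 0 <= gauss (u n.+1) by exact: expR_ge0.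
apply: (@le_trans _ _ (gauss (u n.+1))).
  by rewrite (ger0_norm g0) ler_piMr.
rewrite -[leRHS]mul1r ler_pdivlMr// /gauss expRN mulrC ler_pdivrMr ?expR_gt0// mul1r.
rewrite -(un n.+1); apply: le_trans (ler_norm_expR_sqr _) _.
rewrite ler_expR ler_wpM2r ?sqr_ge0//.
by rewrite ler_pdivrMr// ler_peMr ?pi_ge0// ler1n.
Qed.

(** The derivative of e^(-pi x^2 + i (b x - a x^2)) is that function times
    - (2 pi + 2 i a) x + i b, and its integral is zero. *)
Lemma chirp_by_parts (a b : R) :
  ((2 * pi) +i* (2 * a)) * cintegral leb (chirp id a b) =
  (0 +i* b) * cintegral leb (chirp (cst 1) a b).
Proof.
have i1 := cintegrable_chirp1 a b; have ix := cintegrable_chirp_id a b.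
pose f x := - ((2 * pi) +i* (2 * a)) * chirp id a b x
            + (0 +i* b) * chirp (cst 1) a b x.
have [fr fi] : cintegrable leb f by apply: cintegrableD; exact: cintegrableZ.
have derc x := is_derive_gauss_trig a b x (@is_derive_cos R).
have ders x := is_derive_gauss_trig a b x (@is_derive_sin R).
have cc := is_derive_continuous derc; have cs := is_derive_continuous ders.
have cid : continuous (@id R) by move=> ?; exact: cvg_id.
have cM (k l m : R) (g h : R -> R) : continuous g -> continuous h ->
    continuous (fun x : R => k * (x * g x) + l * (x * h x) + m * h x).
  move=> cg ch x; apply: cvgD; [apply: cvgD|]; apply: cvgM;
    try exact: cvg_cst; try exact: ch.
  - by apply: cvgM; [exact: cid|exact: cg].
  - by apply: cvgM; [exact: cid|exact: ch].
have ref x : complex.Re (f x) =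
    - (2 * pi) * (x * (gauss x * cos (b * x - a * x ^+ 2))) +
    (b - 2 * a * x) * (gauss x * - sin (b * x - a * x ^+ 2)).
  by rewrite /f /chirp /expi /=; ring.
have imf x : complex.Im (f x) =
    - (2 * pi) * (x * (gauss x * sin (b * x - a * x ^+ 2))) +
    (b - 2 * a * x) * (gauss x * cos (b * x - a * x ^+ 2)).
  by rewrite /f /chirp /expi /=; ring.
have E0 : cintegral leb f = 0.
  rewrite /cintegral; congr (_ +i* _).
    apply: (Rintegral_derivative _ _ fr).
    - by move=> x; rewrite ref; exact: derc.
    - rewrite (_ : (fun _ => _) = (fun x =>
        - (2 * pi) * (x * (gauss x * cos (b * x - a * x ^+ 2))) +
        (2 * a) * (x * (gauss x * sin (b * x - a * x ^+ 2))) +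
        - b * (gauss x * sin (b * x - a * x ^+ 2)))).
        exact: cM.
      by apply/funext => x; rewrite ref; ring.
    - apply: cvg_gauss_trig => [y|n]; last by rewrite normr_nat.
      by rewrite ler_norml cos_geN1 cos_le1.
    - apply: cvg_gauss_trig => [y|n]; last by rewrite normrN normr_nat.
      by rewrite ler_norml cos_geN1 cos_le1.
  apply: (Rintegral_derivative _ _ fi).
  - by move=> x; rewrite imf; exact: ders.
  - rewrite (_ : (fun _ => _) = (fun x =>
      - (2 * pi) * (x * (gauss x * sin (b * x - a * x ^+ 2))) +
      - (2 * a) * (x * (gauss x * cos (b * x - a * x ^+ 2))) +
      b * (gauss x * cos (b * x - a * x ^+ 2)))).
      exact: cM.
    by apply/funext => x; rewrite imf; ring.
  - apply: cvg_gauss_trig => [y|n]; last by rewrite normr_nat.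
    by rewrite ler_norml sin_geN1 sin_le1.
  - apply: cvg_gauss_trig => [y|n]; last by rewrite normrN normr_nat.
    by rewrite ler_norml sin_geN1 sin_le1.
move: E0; rewrite cintegralD ?cintegralZ //; try exact: cintegrableZ.
by rewrite mulNr addrC => /subr0_eq.
Qed.

End chirp.

(** * The Fourier transform of the Gaussian *)

Section chirp_fourier.
Context {R : realType}.
Notation leb := (@lebesgue_measure R).

(** Differentiation under the integral sign, dominated by |x| e^(-pi x^2)
    uniformly in the parameter. *)
Lemma is_derive_integral_gauss_trig (t t' : R -> R) (a b : R) :
  (forall y, is_derive y (1 : R) t (t' y)) ->
  (forall y, `|t' y| <= 1) ->
  (forall c, leb.-integrable [set: R]
    (EFin \o (fun x => gauss x * t (c * x - a * x ^+ 2)))) ->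
  is_derive b (1 : R) (fun c => \int[leb]_x (gauss x * t (c * x - a * x ^+ 2)))
    (\int[leb]_x (x * (gauss x * t' (b * x - a * x ^+ 2)))).
Proof.
move=> dt t'1 intt.
pose f (c x : R) := gauss x * t (c * x - a * x ^+ 2).
have df (c x : R) : is_derive c (1 : R) (f ^~ x)
    (x * (gauss x * t' (c * x - a * x ^+ 2))).
  have dp : is_derive c (1 : R) (fun c => c * x - a * x ^+ 2) x.
    rewrite (_ : (fun _ => _) = (x \*: @id R) - cst (a * x ^+ 2)); last first.
      by apply/funext => y; rewrite !fctE /GRing.scale /= mulrC.
    by apply: is_derive_eq; rewrite subr0 /GRing.scale /= mulr1.
  have dtp := @is_derive1_comp _ t (fun c => c * x - a * x ^+ 2) _ _ _ (dt _) dp.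
  rewrite (_ : f ^~ x = gauss x \*: (t \o (fun c => c * x - a * x ^+ 2))) //.
  by apply: is_derive_eq; rewrite /GRing.scale /=; ring.
(* the domination is global, so any neighbourhood of b will do *)
have bI : `]b - 1, b + 1[%classic b by rewrite /= in_itv /= ltrDl gtrBl ltr01.
have d1fE (c x : R) : partial1of2 f c x = x * (gauss x * t' (c * x - a * x ^+ 2)).
  by rewrite partial1of2E; exact: (@derive_val _ _ _ _ _ _ _ (df c x)).
have intG : leb.-integrable [set: R] (EFin \o (fun x => `|x| * gauss x)).
  by apply: (@integrable_gaussM _ _ 1) => // x; left; rewrite normr_id mul1r.
have G0 (x : R) : 0 <= `|x| * gauss x by rewrite mulr_ge0 ?expR_ge0.
have derf (c y : R) : `]b - 1, b + 1[%classic c -> [set: R]%classic y ->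
    derivable (f ^~ y) c 1.
  by move=> _ _; have [] := df c y.
have Gub (c y : R) : `]b - 1, b + 1[%classic c -> [set: R]%classic y ->
    `|partial1of2 f c y| <= `|y| * gauss y.
  move=> _ _; rewrite d1fE !normrM (ger0_norm (expR_ge0 _)).
  by rewrite ler_wpM2l// ler_piMr ?expR_ge0.
apply: DeriveDef.
  exact: (derivable_under_integral measurableT bI (fun c _ => intt c)
    derf G0 intG Gub).
rewrite -derive1E.
rewrite (differentiation_under_integral measurableT bI (fun c _ => intt c)
  derf G0 intG Gub).
by apply: eq_Rintegral => x _; rewrite d1fE.
Qed.

(** The derivative of e^(b^2 / (4 pi)) u(b) vanishes. *)
Lemma gaussian_ode (u : R -> R) :
  (forall b, is_derive b (1 : R) u (- (b / (2 * pi)) * u b)) ->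
  forall b, u b = expR (- (b ^+ 2 / (4 * pi))) * u 0.
Proof.
move=> du b.
have pi0 : (pi : R) != 0 by rewrite gt_eqF ?pi_gt0.
pose w c := expR (c ^+ 2 / (4 * pi)) * u c.
have dw c : is_derive c (1 : R) w 0.
  rewrite (_ : w = (expR \o ((4 * pi)^-1 \*: (@id R ^+ 2))) * u); last first.
    by apply/funext => y; rewrite /w !fctE /GRing.scale /= [_ / (4 * pi)]mulrC.
  have dc := du c.
  apply: is_derive_eq.
  rewrite !fctE expr1 /GRing.scale /=.
  by move: pi0; generalize (pi : R) => p p0; field.
have /= := is_derive_0_is_cst b 0 dw.
rewrite /w expr0n /= mul0r expR0 mul1r => <-.
by rewrite mulrA -expRD addNr expR0 mul1r.
Qed.

(** Real and imaginary parts both satisfy [gaussian_ode]: differentiating in b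
    brings down a factor i x, which [chirp_by_parts] turns back into b. *)
Lemma cintegral_chirp1_gauss (b : R) : cintegral leb (chirp (cst 1) 0 b) =
  (expR (- (b ^+ 2 / (4 * pi))))%:C * cintegral leb (chirp (cst 1) 0 0).
Proof.
have pi0 : (pi : R) != 0 by rewrite gt_eqF ?pi_gt0.
have ReE c : complex.Re (cintegral leb (chirp (cst 1) 0 c)) =
    \int[leb]_x (gauss x * cos (c * x - 0 * x ^+ 2)).
  by apply: eq_Rintegral => x _; rewrite Re_chirp mul1r.
have ImE c : complex.Im (cintegral leb (chirp (cst 1) 0 c)) =
    \int[leb]_x (gauss x * sin (c * x - 0 * x ^+ 2)).
  by apply: eq_Rintegral => x _; rewrite Im_chirp mul1r.
have i1 c : leb.-integrable [set: R]
    (EFin \o (fun x => gauss x * cos (c * x - 0 * x ^+ 2))).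
  rewrite (_ : (fun _ => _) = (fun x => complex.Re (chirp (cst 1) 0 c x))).
    exact: (cintegrable_chirp1 0 c).1.
  by apply/funext => x; rewrite Re_chirp mul1r.
have i2 c : leb.-integrable [set: R]
    (EFin \o (fun x => gauss x * sin (c * x - 0 * x ^+ 2))).
  rewrite (_ : (fun _ => _) = (fun x => complex.Im (chirp (cst 1) 0 c x))).
    exact: (cintegrable_chirp1 0 c).2.
  by apply/funext => x; rewrite Im_chirp mul1r.
have parts c : (2 * pi) * complex.Re (cintegral leb (chirp id 0 c)) =
      - c * complex.Im (cintegral leb (chirp (cst 1) 0 c)) /\
    (2 * pi) * complex.Im (cintegral leb (chirp id 0 c)) =
      c * complex.Re (cintegral leb (chirp (cst 1) 0 c)).
  move: (chirp_by_parts 0 c).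
  case: (cintegral leb (chirp id 0 c)) => B1 B2.
  case: (cintegral leb (chirp (cst 1) 0 c)) => A1 A2 [/= e1 e2].
  by split; [move: e1|move: e2]; rewrite mulr0 !mul0r => e; lra.
have ode1 c : is_derive c (1 : R)
    (fun c => complex.Re (cintegral leb (chirp (cst 1) 0 c)))
    (- (c / (2 * pi)) * complex.Re (cintegral leb (chirp (cst 1) 0 c))).
  rewrite (_ : (fun _ => _) =
    (fun c => \int[leb]_x (gauss x * cos (c * x - 0 * x ^+ 2)))); last exact/funext.
  have := is_derive_integral_gauss_trig c (@is_derive_cos R) _ i1.
  move=> H; apply: is_derive_eq (H _) _.
    by move=> y; rewrite normrN ler_norml sin_geN1 sin_le1.
  have -> : \int[leb]_x (x * (gauss x * - sin (c * x - 0 * x ^+ 2))) =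
      - complex.Im (cintegral leb (chirp id 0 c)).
    rewrite -mulN1r -RintegralZl //; last exact: (cintegrable_chirp_id 0 c).2.
    by apply: eq_Rintegral => x _; rewrite Im_chirp; ring.
  have [_ e] := parts c.
  apply: (@mulfI _ (2 * pi)); first by rewrite mulf_neq0.
  by rewrite mulrN e; move: pi0; generalize (pi : R) => p p0; field.
have ode2 c : is_derive c (1 : R)
    (fun c => complex.Im (cintegral leb (chirp (cst 1) 0 c)))
    (- (c / (2 * pi)) * complex.Im (cintegral leb (chirp (cst 1) 0 c))).
  rewrite (_ : (fun _ => _) =
    (fun c => \int[leb]_x (gauss x * sin (c * x - 0 * x ^+ 2)))); last exact/funext.
  have := is_derive_integral_gauss_trig c (@is_derive_sin R) _ i2.
  move=> H; apply: is_derive_eq (H _) _.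
    by move=> y; rewrite ler_norml cos_geN1 cos_le1.
  have -> : \int[leb]_x (x * (gauss x * cos (c * x - 0 * x ^+ 2))) =
      complex.Re (cintegral leb (chirp id 0 c)).
    by apply: eq_Rintegral => x _; rewrite Re_chirp.
  have [e _] := parts c.
  apply: (@mulfI _ (2 * pi)); first by rewrite mulf_neq0.
  by rewrite e; move: pi0; generalize (pi : R) => p p0; field.
have := gaussian_ode ode1 b; have := gaussian_ode ode2 b.
case: (cintegral leb (chirp (cst 1) 0 b)) => x y.
case: (cintegral leb (chirp (cst 1) 0 0)) => x0 y0 /= -> ->.
by simpc.
Qed.

End chirp_fourier.

(** * Integrals of tensor products *)

Section product.
Context d1 d2 (T1 : measurableType d1) (T2 : measurableType d2) (R : realType).
Variable m1 : {sigma_finite_measure set T1 -> \bar R}.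
Variable m2 : {sigma_finite_measure set T2 -> \bar R}.

(** By Tonelli, the integral of |f(x) g(y)| is the product of those of |f| and |g|. *)
Lemma integrable_prodM (f : T1 -> R) (g : T2 -> R) :
  m1.-integrable [set: T1] (EFin \o f) -> m2.-integrable [set: T2] (EFin \o g) ->
  (m1 \x m2)%E.-integrable [set: T1 * T2] (EFin \o (fun z => f z.1 * g z.2)).
Proof.
move=> intf intg.
have mf : measurable_fun [set: T1] f by apply/measurable_EFinP/measurable_int/intf.
have mg : measurable_fun [set: T2] g by apply/measurable_EFinP/measurable_int/intg.
apply/integrable12ltyP => /=.
  apply/measurable_EFinP/measurable_funM; exact: measurableT_comp.
rewrite (eq_integral (fun x => `|(f x)%:E| * \int[m2]_y `|(g y)%:E|)%E); last first.
  move=> x _; rewrite -ge0_integralZl//.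
  - by apply: eq_integral => y _; rewrite -abseM.
  - by apply: measurableT_comp => //; exact/measurable_EFinP.
have /integrableP[_ goo] := intg; have /integrableP[_ foo] := intf.
have gfin : (\int[m2]_y `|(g y)%:E|)%E \is a fin_num.
  by rewrite ge0_fin_numE ?integral_ge0.
rewrite -(fineK gfin) ge0_integralZr//.
- by rewrite lte_mul_pinfty ?integral_ge0 // ?ge0_fin_numE ?integral_ge0 // ltry.
- by apply: measurableT_comp => //; exact/measurable_EFinP.
- by rewrite fineK // integral_ge0.
Qed.

Lemma Rintegral_prodM (f : T1 -> R) (g : T2 -> R) :
  m1.-integrable [set: T1] (EFin \o f) -> m2.-integrable [set: T2] (EFin \o g) ->
  \int[(m1 \x m2)%E]_z (f z.1 * g z.2) = \int[m1]_x f x * \int[m2]_y g y.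
Proof.
move=> intf intg.
have intfg := integrable_prodM intf intg.
rewrite {1}/Rintegral -(integral12_prod_meas1 intfg) /fubini_F /=.
rewrite (eq_integral (fun x => (f x * \int[m2]_y g y)%:E)); last first.
  move=> x _; under eq_integral do rewrite EFinM.
  rewrite integralZl // EFinM /Rintegral fineK //.
  exact: (integrable_fin_num _ intg).
by rewrite -RintegralZr.
Qed.

Lemma cintegrable_prodM (F : T1 -> R[i]) (G : T2 -> R[i]) :
  cintegrable m1 F -> cintegrable m2 G ->
  cintegrable (m1 \x m2)%E (fun z => F z.1 * G z.2).
Proof.
move=> [F1 F2] [G1 G2]; split.
  have := integrableB measurableT (integrable_prodM F1 G1) (integrable_prodM F2 G2).
  by apply: eq_integrable => // z _; rewrite /= ReM.
have := integrableD measurableT (integrable_prodM F1 G2) (integrable_prodM F2 G1).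
by apply: eq_integrable => // z _; rewrite /= ImM.
Qed.

Lemma cintegral_prodM (F : T1 -> R[i]) (G : T2 -> R[i]) :
  cintegrable m1 F -> cintegrable m2 G ->
  cintegral (m1 \x m2)%E (fun z => F z.1 * G z.2) = cintegral m1 F * cintegral m2 G.
Proof.
move=> [F1 F2] [G1 G2]; rewrite /cintegral.
under eq_Rintegral do rewrite ReM.
under [X in _ +i* X = _]eq_Rintegral do rewrite ImM.
rewrite RintegralB //; [|exact: (integrable_prodM F1 G1)|exact: (integrable_prodM F2 G2)].
rewrite RintegralD //; [|exact: (integrable_prodM F1 G2)|exact: (integrable_prodM F2 G1)].
by rewrite (Rintegral_prodM F1 G1) (Rintegral_prodM F2 G2)
  (Rintegral_prodM F1 G2) (Rintegral_prodM F2 G1).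
Qed.

End product.

Section tensor.
Context {R : realType}.
Notation leb := (@lebesgue_measure R).

Lemma cintegral_lebesgue_step n
    (mu : {sigma_finite_measure set (n.-tuple (measurableTypeR R)) -> \bar R})
    (F : n.+1.-tuple (measurableTypeR R) -> R[i]) :
  measurable_fun setT (fun t => complex.Re (F t)) ->
  measurable_fun setT (fun t => complex.Im (F t)) ->
  cintegrable (leb \x mu)%E (F \o @cons_pair _ n) ->
  cintegrable (lebesgue_step mu) F /\
  cintegral (lebesgue_step mu) F = cintegral (leb \x mu)%E (F \o @cons_pair _ n).
Proof.
move=> mF1 mF2 [int1 int2].
have mc := @measurable_cons_pair _ (measurableTypeR R) n.
have m1 : measurable_fun setT (EFin \o (fun t => complex.Re (F t))).
  exact/measurable_EFinP.
have m2 : measurable_fun setT (EFin \o (fun t => complex.Im (F t))).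
  exact/measurable_EFinP.
split; first split.
- exact: (integrable_pushforward mc m1 int1).
- exact: (integrable_pushforward mc m2 int2).
- rewrite /cintegral /Rintegral; congr (fine _ +i* fine _).
  + exact: (integral_pushforward mc m1 int1).
  + exact: (integral_pushforward mc m2 int2).
Qed.

Lemma measurable_tensor n (phi : 'I_n -> R -> R[i]) :
  (forall i, cintegrable leb (phi i)) ->
  let F (t : n.-tuple (measurableTypeR R)) := \prod_(i < n) phi i (tnth t i) in
  measurable_fun setT (fun t => complex.Re (F t)) /\
  measurable_fun setT (fun t => complex.Im (F t)).
Proof.
move=> int /=.
have mtnth (i : 'I_n) :
    measurable_fun [set: n.-tuple (measurableTypeR R)] (@tnth n R ^~ i).
  exact: measurable_tnth.
elim: (index_enum _) => [|i s [IH1 IH2]].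
  by split; under eq_fun do rewrite big_nil; exact: measurable_cst.
have mre : measurable_fun [set: n.-tuple (measurableTypeR R)]
    (fun t => complex.Re (phi i (tnth t i))).
  have m := measurable_int _ (int i).1.
  by have /measurable_EFinP m' := m; exact: (measurableT_comp m' (mtnth i)).
have mim : measurable_fun [set: n.-tuple (measurableTypeR R)]
    (fun t => complex.Im (phi i (tnth t i))).
  have m := measurable_int _ (int i).2.
  by have /measurable_EFinP m' := m; exact: (measurableT_comp m' (mtnth i)).
split.
  rewrite (_ : (fun _ => _) = (fun t =>
    complex.Re (phi i (tnth t i)) * complex.Re (\prod_(j <- s) phi j (tnth t j)) -
    complex.Im (phi i (tnth t i)) * complex.Im (\prod_(j <- s) phi j (tnth t j)))).
    by apply: measurable_funB; apply: measurable_funM.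
  apply/funext => t; rewrite big_cons.
  by case: (phi i _); case: (\prod_(j <- s) _).
rewrite (_ : (fun _ => _) = (fun t =>
  complex.Re (phi i (tnth t i)) * complex.Im (\prod_(j <- s) phi j (tnth t j)) +
  complex.Im (phi i (tnth t i)) * complex.Re (\prod_(j <- s) phi j (tnth t j)))).
  by apply: measurable_funD; apply: measurable_funM.
apply/funext => t; rewrite big_cons.
by case: (phi i _); case: (\prod_(j <- s) _).
Qed.

(** Fubini's theorem, one coordinate at a time along the recursive construction
    of the measure. *)
Lemma cintegral_tensor n (phi : 'I_n -> R -> R[i]) :
  (forall i, cintegrable leb (phi i)) ->
  let F (t : n.-tuple (measurableTypeR R)) := \prod_(i < n) phi i (tnth t i) in
  cintegrable (lebesgue_Rn R n) F /\
  cintegral (lebesgue_Rn R n) F = \prod_(i < n) cintegral leb (phi i).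
Proof.
elim: n phi => [|n IH] phi int F.
  have -> : F = cst 1 by apply/funext => t; rewrite /F big_ord0.
  rewrite big_ord0 /=; split.
    by split; exact: finite_measure_integrable_cst.
  have mass1 : lebesgue_Rn R 0 setT = 1%E by exact: diracT.
  rewrite /cintegral !Rintegral_cst //; congr (_ +i* _); last by rewrite mul0r.
  by transitivity (1 * fine (1%E : \bar R)); [congr (_ * fine _)|rewrite mul1r].
have [mF1 mF2] := measurable_tensor int.
pose G (t : n.-tuple (measurableTypeR R)) := \prod_(i < n) phi (lift ord0 i) (tnth t i).
have [intG GE] := IH (fun i => phi (lift ord0 i)) (fun i => int _).
have FE : F \o @cons_pair _ n = (fun z => phi ord0 z.1 * G z.2).
  apply/funext => z; rewrite /F /= big_ord_recl; congr (_ * _).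
  by apply: eq_bigr => i _; rewrite tnthS.
have intFG := cintegrable_prodM (int ord0) intG.
have [] := @cintegral_lebesgue_step n (lebesgue_Rn R n) F mF1 mF2.
  by rewrite FE.
move=> intF FI; split; first exact: intF.
rewrite [LHS]FI FE (cintegral_prodM (int ord0) intG) big_ord_recl.
by congr (_ * _); exact: GE.
Qed.

End tensor.

(** * Evolution of vortices *)

Section vortex.
Context {R : realType} (n : nat).
Notation leb := (@lebesgue_measure R).
Implicit Types (x xi : 'rV[R]_n) (i j k : 'I_n).

Lemma expiD (a b : R) : expi (a + b) = expi a * expi b.
Proof. by rewrite /expi cosD sinD; simpc; rewrite [X in _ +i* X]addrC. Qed.

Lemma expi_sum (I : Type) (r : seq I) (h : I -> R) :
  expi (\sum_(l <- r) h l) = \prod_(l <- r) expi (h l).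
Proof.
elim: r => [|l r IH]; last by rewrite !big_cons expiD IH.
by rewrite !big_nil /expi cos0 sin0.
Qed.

Definition gaussn x : R := expR (- (pi * dot x x)).

Lemma gaussnE x : gaussn x = \prod_l gauss (x ord0 l).
Proof.
rewrite /gaussn /dot mulr_sumr -sumrN expR_sum.
by apply: eq_bigr => l _; rewrite /gauss expr2.
Qed.

(** The circulation is c = i or c = - i; leaving c free treats both at once. *)
Definition vortex i j (c : R[i]) x : R[i] :=
  ((x ord0 i)%:C + c * (x ord0 j)%:C) * (gaussn x)%:C.

(** The coordinate x_k as a tensor product: its k-th factor is the identity and
    the others are constant. *)
Definition monomial_factor k l : R -> R := if l == k then id else cst 1.

Lemma cintegrable_factor k l a b : cintegrable leb (chirp (monomial_factor k l) a b).
Proof.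
rewrite /monomial_factor; case: ifP => _.
  exact: cintegrable_chirp_id.
exact: cintegrable_chirp1.
Qed.

Lemma prod_chirp k a (b : 'I_n -> R) x :
  \prod_l chirp (monomial_factor k l) a (b l) (x ord0 l) =
  (x ord0 k)%:C * (gaussn x)%:C * expi (\sum_l (b l * x ord0 l - a * x ord0 l ^+ 2)).
Proof.
rewrite expi_sum gaussnE rmorph_prod /chirp big_split /=; congr (_ * _).
rewrite (eq_bigr (fun l => (monomial_factor k l (x ord0 l))%:C * (gauss (x ord0 l))%:C)).
  rewrite big_split /=; congr (_ * _).
  rewrite (bigD1 k) //= /monomial_factor eqxx big1 ?mulr1 // => l lk.
  by rewrite (negbTE lk).
by move=> l _; rewrite rmorphM.
Qed.

Lemma cintegral_chirp_id a b : cintegral leb (chirp id a b) =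
  'i / ((2 * pi) +i* (2 * a)) * b%:C * cintegral leb (chirp (cst 1) a b).
Proof.
have den0 : (2 * pi) +i* (2 * a) != 0 :> R[i].
  by rewrite eq_complex /= negb_and mulf_neq0 // gt_eqF ?pi_gt0.
apply: (mulfI den0); rewrite chirp_by_parts.
rewrite (_ : 0 +i* b = 'i * b%:C); last by simpc.
by field.
Qed.

Lemma integral_prod_chirp k a (b : 'I_n -> R) :
  \prod_l cintegral leb (chirp (monomial_factor k l) a (b l)) =
  'i / ((2 * pi) +i* (2 * a)) * (b k)%:C * \prod_l cintegral leb (chirp (cst 1) a (b l)).
Proof.
rewrite (bigD1 k) //= /monomial_factor eqxx cintegral_chirp_id.
rewrite [in RHS](bigD1 k) //= mulrA; congr (_ * _).
by apply: eq_bigr => l lk; rewrite (negbTE lk).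
Qed.

(** Each term of the vortex inserts one coordinate in the Gaussian integral,
    hence one frequency as a factor in front, and the remaining product is common
    to both terms.  The constant [kappa] anticipates the eigenvalue of the Fourier
    transform, which has to come out of the second integral. *)
Lemma integral_vortex i j (kappa c : R[i]) a (b : 'I_n -> R) :
  integral_Rn (fun x => kappa *
    (expi (\sum_l (b l * x ord0 l - a * x ord0 l ^+ 2)) * vortex i j c x)) =
  kappa * ((b i)%:C + c * (b j)%:C) *
  ('i / ((2 * pi) +i* (2 * a)) * \prod_l cintegral leb (chirp (cst 1) a (b l))).
Proof.
pose F k (t : n.-tuple (measurableTypeR R)) : R[i] :=
  \prod_l chirp (monomial_factor k l) a (b l) (tnth t l).
have [intFi FiE] := cintegral_tensor (fun l => cintegrable_factor i l a (b l)).
have [intFj FjE] := cintegral_tensor (fun l => cintegrable_factor j l a (b l)).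
transitivity (cintegral (lebesgue_Rn R n) (fun t => kappa * (F i t + c * F j t))).
  rewrite /integral_Rn /=; congr (cintegral _ _); apply/funext => t.
  have FE k : F k t =
      \prod_l chirp (monomial_factor k l) a (b l) ((\row_l tnth t l : 'rV[R]_n) ord0 l).
    by apply: eq_bigr => l _; rewrite mxE.
  by rewrite !FE !prod_chirp /vortex; ring.
have intcFj := cintegrableZ c intFj.
rewrite (cintegralZ kappa (cintegrableD intFi intcFj)).
rewrite (cintegralD intFi intcFj) (cintegralZ c intFj).
rewrite integral_prod_chirp in FiE; rewrite integral_prod_chirp in FjE.
rewrite [X in X + _]FiE [X in c * X]FjE.
by ring.
Qed.

(** Up to a constant, the chirp integrals at a = 0 and b = - 2 pi xi_l multiply to
    the Gaussian in xi. *)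
Lemma fourier_vortex i j : exists kappa : R[i],
  forall c xi, fourier (vortex i j c) xi = kappa * vortex i j c xi.
Proof.
pose A00 := cintegral leb (chirp (cst 1) 0 0).
exists ((- (2 * pi))%:C * ('i / ((2 * pi) +i* (2 * 0)) * A00 ^+ n)) => c xi.
pose b l := - (2 * pi) * xi ord0 l.
transitivity (integral_Rn (fun x => 1 *
    (expi (\sum_l (b l * x ord0 l - 0 * x ord0 l ^+ 2)) * vortex i j c x))).
  congr integral_Rn; apply/funext => x; rewrite mul1r; congr (expi _ * _).
  rewrite /dot mulr_sumr -sumrN; apply: eq_bigr => l _.
  by rewrite /b; ring.
rewrite integral_vortex.
have -> : \prod_l cintegral leb (chirp (cst 1) 0 (b l)) = (gaussn xi)%:C * A00 ^+ n.
  have -> : A00 ^+ n = \prod_(l < n) A00 by rewrite prodr_const card_ord.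
  rewrite gaussnE rmorph_prod -big_split /=.
  apply: eq_bigr => l _; rewrite cintegral_chirp1_gauss; congr (_%:C * _).
  rewrite /gauss /b; congr (expR (- _)).
  have: (pi : R) != 0 by rewrite gt_eqF ?pi_gt0.
  by generalize (pi : R) => p p0; field.
by rewrite /vortex /b !rmorphM /=; ring.
Qed.

(** The multiplier adds the quadratic phase 4 pi^2 t to the transformed vortex, a
    chirp integral again, at the frequencies 2 pi x_l; the factor K is quantified
    before [c], hence common to all circulations. *)
Lemma schrodinger_vortex i j : exists K : R -> 'rV[R]_n -> R[i],
  forall c t x, schrodinger t (vortex i j c) x =
     K t x * ((x ord0 i)%:C + c * (x ord0 j)%:C).
Proof.
have [kappa fourierE] := fourier_vortex i j.
pose a (t : R) : R := 4 * pi ^+ 2 * t.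
exists (fun t x => (2 * pi)%:C * (kappa * ('i / ((2 * pi) +i* (2 * a t)) *
  \prod_l cintegral leb (chirp (cst 1) (a t) (2 * pi * x ord0 l))))) => c t x.
pose b l := 2 * pi * x ord0 l.
transitivity (integral_Rn (fun xi => kappa *
    (expi (\sum_l (b l * xi ord0 l - a t * xi ord0 l ^+ 2)) * vortex i j c xi))).
  congr integral_Rn; apply/funext => xi; rewrite fourierE.
  rewrite sumrB expiD mulrA.
  have -> : 2 * pi * dot x xi = \sum_l b l * xi ord0 l.
    by rewrite /dot mulr_sumr; apply: eq_bigr => l _; rewrite /b; ring.
  have -> : 4 * pi ^+ 2 * t * dot xi xi = \sum_l a t * xi ord0 l ^+ 2.
    by rewrite /dot mulr_sumr; apply: eq_bigr => l _; rewrite /a expr2.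
  by ring.
by rewrite integral_vortex /b !rmorphM /=; ring.
Qed.

End vortex.

(** * Polynomials times Gaussians are Schwartz *)

Section poly_gauss.
Context {R : realType} (n : nat).
Local Notation V := 'rV[R]_n.

(** An inductive predicate on functions: differentiability, derivatives and the
    growth bound then follow by the same induction. *)
Inductive polyfun : (V -> R) -> Prop :=
| polyfun_cst c : polyfun (cst c)
| polyfun_coord i : polyfun (fun x => x ord0 i)
| polyfunD p q : polyfun p -> polyfun q -> polyfun (p + q)
| polyfunM p q : polyfun p -> polyfun q -> polyfun (p * q).

Lemma polyfun_differentiable p : polyfun p -> forall x, differentiable p x.
Proof.
elim=> [c|i|{}p q _ dp _ dq|{}p q _ dp _ dq] x.
- exact: differentiable_cst.
- exact: differentiable_coord.
- exact: differentiableD.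
- exact: differentiableM.
Qed.

Lemma is_derive_coord (i : 'I_n) (x v : V) :
  is_derive x v (fun y : V => y ord0 i : R) (v ord0 i).
Proof.
have cv : h^-1 *: (((fun y : V => y ord0 i) \o shift x) (h *: v) - x ord0 i)
    @[h --> (0 : R)^'] --> (v ord0 i : R).
  apply: cvg_near_cst; near=> h.
  have h0 : h != 0 by near: h; exact: nbhs_dnbhs_neq.
  by rewrite /= !mxE addrK scalerA mulVf // scale1r.
by apply: DeriveDef; [apply/cvg_ex; exists (v ord0 i)|exact: cvg_lim].
Unshelve. all: end_near. Qed.

Lemma polyfun_derive p (v : V) : polyfun p ->
  exists2 p', polyfun p' & forall x, is_derive x v p (p' x).
Proof.
elim=> [c|i|{}p q Pp [p' Pp' dp] Pq [q' Pq' dq]|{}p q Pp [p' Pp' dp] Pq [q' Pq' dq]].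
- by exists (cst 0); [exact: polyfun_cst|move=> x; exact: is_derive_cst].
- exists (cst (v ord0 i)); first exact: polyfun_cst.
  by move=> x; exact: is_derive_coord.
- by exists (p' + q'); [exact: polyfunD|move=> x; exact: is_deriveD].
- exists (p * q' + q * p'); first by apply: polyfunD; exact: polyfunM.
  by move=> x; exact: is_deriveM.
Qed.

Lemma polyfun_sum (I : Type) (r : seq I) (p : I -> V -> R) :
  (forall l, polyfun (p l)) -> polyfun (fun x => \sum_(l <- r) p l x).
Proof.
move=> Pp; elim: r => [|l r IH].
  rewrite (_ : (fun _ => _) = cst 0); first exact: polyfun_cst.
  by apply/funext => x; rewrite big_nil.
rewrite (_ : (fun _ => _) = p l + (fun x => \sum_(l <- r) p l x)); first exact: polyfunD.
by apply/funext => x; rewrite big_cons.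
Qed.

Lemma polyfun_prod (I : Type) (r : seq I) (p : I -> V -> R) :
  (forall l, polyfun (p l)) -> polyfun (fun x => \prod_(l <- r) p l x).
Proof.
move=> Pp; elim: r => [|l r IH].
  rewrite (_ : (fun _ => _) = cst 1); first exact: polyfun_cst.
  by apply/funext => x; rewrite big_nil.
rewrite (_ : (fun _ => _) = p l * (fun x => \prod_(l <- r) p l x)); first exact: polyfunM.
by apply/funext => x; rewrite big_cons.
Qed.

Lemma polyfun_monomial a : polyfun (@monomial R n a).
Proof.
apply: polyfun_prod => l; elim: (a l) => [|m IH].
  rewrite (_ : (fun _ => _) = cst 1); first exact: polyfun_cst.
  by apply/funext => x; rewrite expr0.
rewrite (_ : (fun _ => _) = (fun x : V => x ord0 l) * (fun x => x ord0 l ^+ m)).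
  by apply: polyfunM => //; exact: polyfun_coord.
by apply/funext => x; rewrite exprS.
Qed.

Lemma polyfun_dot : polyfun (fun x => dot x x).
Proof.
apply: polyfun_sum => l.
by rewrite (_ : (fun _ => _) = (fun x : V => x ord0 l) * (fun x => x ord0 l));
  [apply: polyfunM; exact: polyfun_coord|].
Qed.

Lemma dot_ge0 (x : V) : 0 <= dot x x.
Proof. by apply: sumr_ge0 => l _; rewrite -expr2 sqr_ge0. Qed.

(** A product is bounded by giving eps / 2 to each factor, which is why the bound
    is proved for all eps at once; for a coordinate, |x_i| <= 1 + x_i^2 and
    1 + eps |x|^2 <= e^(eps |x|^2). *)
Lemma polyfun_le_expR p : polyfun p -> forall e : R, 0 < e ->
  exists2 C : R, 0 <= C & forall x, `|p x| <= C * expR (e * dot x x).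
Proof.
elim=> [c|i|{}p q _ IHp _ IHq|{}p q _ IHp _ IHq] e e0.
- exists `|c| => // x; rewrite ler_peMr //.
  by rewrite -[leLHS]expR0 ler_expR mulr_ge0 ?dot_ge0 // ltW.
- exists (1 + e^-1); first by rewrite addr_ge0 // invr_ge0 ltW.
  move=> x; have le_dot : x ord0 i ^+ 2 <= dot x x.
    rewrite /dot (bigD1 i) //= -expr2 lerDl.
    by apply: sumr_ge0 => l _; rewrite -expr2 sqr_ge0.
  apply: (@le_trans _ _ ((1 + e^-1) * (1 + e * dot x x))); last first.
    by rewrite ler_wpM2l ?expR_ge1Dx // addr_ge0 // invr_ge0 ltW.
  have : `|x ord0 i| <= 1 + `|x ord0 i| ^+ 2 by nra.
  rewrite real_normK ?num_real // => /le_trans; apply.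
  have e'0 : 0 < (e^-1)%R by rewrite invr_gt0.
  rewrite mulrDl mul1r mulrDr mulr1 mulrA mulVf ?gt_eqF // mul1r.
  have := dot_ge0 x => d0.
  have : 0 <= e * dot x x by rewrite mulr_ge0 // ltW.
  by lra.
- have [C C0 Cp] := IHp e e0; have [D D0 Dq] := IHq e e0.
  exists (C + D); first exact: addr_ge0.
  by move=> x; rewrite mulrDl (le_trans (ler_normD _ _)) ?lerD.
- have e20 : 0 < e / 2 by rewrite divr_gt0.
  have [C C0 Cp] := IHp _ e20; have [D D0 Dq] := IHq _ e20.
  exists (C * D); first exact: mulr_ge0.
  move=> x; rewrite normrM.
  have -> : C * D * expR (e * dot x x) =
      (C * expR (e / 2 * dot x x)) * (D * expR (e / 2 * dot x x)).
    by rewrite mulrACA -expRD; congr (_ * expR _); field.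
  exact: ler_pM.
Qed.

Lemma is_derive_comp_expR (q : V -> R) (q' : R) (x v : V) : differentiable q x ->
  is_derive x v q q' -> is_derive x v (expR \o q) (q' * expR (q x)).
Proof.
move=> dq [_ <-].
have de : differentiable (@expR R) (q x) by apply/derivable1_diffP.
apply: DeriveDef; first exact/diff_derivable/differentiable_comp.
rewrite deriveE; last exact: differentiable_comp.
rewrite diff_comp //= diff1E // derive1E.
by rewrite (@derive_val _ _ _ _ _ _ _ (is_derive_expR (q x))) -deriveE.
Qed.

Definition poly_gauss (u : V -> R) := exists2 p, polyfun p & u = p * @gaussn R n.

Lemma gaussn_comp :
  @gaussn R n = expR \o (cst (- pi) * (fun x : V => dot x x)).
Proof. by apply/funext => x; rewrite /gaussn /= !fctE mulNr. Qed.

Lemma polyfun_exponent : polyfun (cst (- pi) * (fun x : V => dot x x)).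
Proof. by apply: polyfunM; [exact: polyfun_cst|exact: polyfun_dot]. Qed.

Lemma differentiable_gaussn (x : V) : differentiable (@gaussn R n) x.
Proof.
rewrite gaussn_comp; apply: differentiable_comp; last exact/derivable1_diffP.
exact: polyfun_differentiable polyfun_exponent x.
Qed.

Lemma poly_gauss_derive u (v : V) : poly_gauss u ->
  poly_gauss ('D_v u) /\ forall x, derivable u x v.
Proof.
case=> p Pp ->.
have [p' Pp' dp] := polyfun_derive v Pp.
have [q' Pq' dq] := polyfun_derive v polyfun_exponent.
have d x : is_derive x v (p * @gaussn R n) ((p' + p * q') x * gaussn x).
  have dg : is_derive x v (@gaussn R n) (q' x * gaussn x).
    rewrite gaussn_comp; apply: is_derive_comp_expR => //.
    exact: polyfun_differentiable polyfun_exponent x.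
  apply: is_derive_eq; rewrite !fctE /GRing.scale /=; ring.
split; last by move=> x; have [] := d x.
exists (p' + p * q'); first by apply: polyfunD => //; exact: polyfunM.
by apply/funext => x; exact: (@derive_val _ _ _ _ _ _ _ (d x)).
Qed.

Lemma poly_gauss_continuous u : poly_gauss u -> continuous u.
Proof.
case=> p Pp -> x; apply: differentiable_continuous.
apply: differentiableM; last exact: differentiable_gaussn.
exact: polyfun_differentiable.
Qed.

(** [polyfun_le_expR] with eps = pi, the rate of the Gaussian. *)
Lemma poly_gauss_bounded p u : polyfun p -> poly_gauss u ->
  exists C : R, forall x, `|p x * u x| <= C.
Proof.
move=> Pp [q Pq ->].
have [C _ CE] := polyfun_le_expR (polyfunM Pp Pq) (pi_gt0 R).
exists C => x; rewrite !fctE mulrA normrM (ger0_norm (expR_ge0 _)).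
by rewrite /gaussn expRN ler_pdivrMr ?expR_gt0 //; exact: CE.
Qed.

Lemma poly_gauss_partials s (f : V -> R[i]) :
  poly_gauss (@complex.Re R \o f) -> poly_gauss (@complex.Im R \o f) ->
  poly_gauss (@complex.Re R \o partials s f) /\
  poly_gauss (@complex.Im R \o partials s f).
Proof.
move=> fr fi; elim: s => [//|i s [IHr IHi]].
split; first exact: (poly_gauss_derive _ IHr).1.
exact: (poly_gauss_derive _ IHi).1.
Qed.

Lemma poly_gauss_schwartz (f : V -> R[i]) :
  poly_gauss (@complex.Re R \o f) -> poly_gauss (@complex.Im R \o f) -> schwartz f.
Proof.
move=> fr fi; split=> [s u v|a s].
  have [Pu Pv] := poly_gauss_partials s fr fi.
  split; try exact: poly_gauss_continuous.
    by move=> i x; exact: (poly_gauss_derive _ Pu).2.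
  by move=> i x; exact: (poly_gauss_derive _ Pv).2.
have [Pu Pv] := poly_gauss_partials s fr fi.
have [C CE] := poly_gauss_bounded (polyfun_monomial a) Pu.
have [D DE] := poly_gauss_bounded (polyfun_monomial a) Pv.
exists (C + D) => x; move: (CE x) (DE x) => /=.
case: (partials s f x) => y z /= yC zD.
have -> : (monomial a x)%:C * (y +i* z) =
    (monomial a x * y)%:C + 'i * (monomial a x * z)%:C by simpc.
apply: (le_trans (ler_normD _ _)); rewrite normrM normCi mul1r.
have normR (r : R) : `|r%:C| = `|r|%:C by rewrite normc_def /= expr0n addr0 sqrtr_sqr.
by rewrite !normR rmorphD lerD // lecR.
Qed.

End poly_gauss.

Section vortex_schwartz.
Context {R : realType} (n : nat).

Lemma schwartz_vortex (i j : 'I_n) (c : R[i]) : schwartz (vortex i j c).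
Proof.
case: c => c1 c2; apply: poly_gauss_schwartz.
  exists ((fun x => x ord0 i) + cst c1 * (fun x => x ord0 j)).
    apply: polyfunD; first exact: polyfun_coord.
    by apply: polyfunM; [exact: polyfun_cst|exact: polyfun_coord].
  by apply/funext => x; rewrite !fctE /= /vortex; simpc => /=; ring.
exists (cst c2 * (fun x => x ord0 j)).
  by apply: polyfunM; [exact: polyfun_cst|exact: polyfun_coord].
by apply/funext => x; rewrite !fctE /= /vortex; simpc => /=; ring.
Qed.

(** Evaluate the relation at the basis vectors e_i and e_j. *)
Lemma linearly_independent_vortex (i j : 'I_n) (c c' : R[i]) : i != j -> c != c' ->
  linearly_independent (vortex i j c) (vortex i j c').
Proof.
move=> ij cc' a b ab0.
have gauss0 (x : 'rV[R]_n) : (gaussn x)%:C != 0 :> R[i].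
  by rewrite eq_complex /= negb_and gt_eqF ?expR_gt0.
have e0 (x : 'rV[R]_n) : a * ((x ord0 i)%:C + c * (x ord0 j)%:C) +
    b * ((x ord0 i)%:C + c' * (x ord0 j)%:C) = 0.
  apply: (mulIf (gauss0 x)); rewrite mul0r -[RHS](ab0 x) /vortex; ring.
have := e0 (delta_mx ord0 i); have := e0 (delta_mx ord0 j).
rewrite !mxE !eqxx (negbTE ij) [_ == i]eq_sym (negbTE ij) /=.
rewrite !mulr0 !add0r !addr0 !mulr1 => acbc' ab.
have ba : b = - a by apply/eqP; rewrite -addr_eq0 addrC ab.
have : a * (c - c') = 0 by rewrite -[RHS]acbc' ba; ring.
move=> /eqP; rewrite mulf_eq0 subr_eq0 (negbTE cc') orbF => /eqP a0.
by rewrite ba a0 oppr0.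
Qed.

End vortex_schwartz.

Theorem theorem3 (R : realType) (d : nat) (hd : (2 <= d)%N) :
  exists f g : 'rV[R]_d -> R[i],
    [/\ schwartz f, schwartz g, linearly_independent f g &
        forall (t : R) (x : 'rV[R]_d),
          `|schrodinger t f x| = `|schrodinger t g x|].
Proof.
pose i : 'I_d := Ordinal (ltnW hd); pose j : 'I_d := Ordinal hd.
exists (vortex i j 'i), (vortex i j (- 'i)); split.
- exact: schwartz_vortex.
- exact: schwartz_vortex.
- apply: linearly_independent_vortex => //.
  by rewrite eq_complex /= oppr0 eqxx /= -subr_eq0 opprK.
- move=> t x; have [K KE] := @schrodinger_vortex R d i j.
  rewrite !KE !normrM; congr (_ * _).
  rewrite (_ : _ + 'i * _ = x ord0 i +i* x ord0 j); last by simpc.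
  rewrite (_ : _ + - 'i * _ = x ord0 i -i* x ord0 j); last by simpc.
  by rewrite !normc_def /= sqrrN.
Qed.
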